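(* Let $Q$ be a directed graph, $w=e_1\cdots e_n$ a primitive cycle in $Q$, $\lambda\in\overline{\mathbb{D}}$ with $\lambda\neq 0$, and $\mu\in\mathbb{T}$. Let $D:\mathcal{T}^{+}(Q)\to M_n$ be a continuous derivation at $\pi_{w,\lambda,\mu}$. Then $D$ is inner at $\pi_{w,\lambda,\mu}$ if and only if $D(a)=0$ for all $a\in\ker(\pi_{w,\lambda,\mu})$.
   Context: A directed graph $Q$ has vertex set $V(Q)$, edge set $E(Q)$, and range and source maps $r,s:E(Q)\to V(Q)$. A finite path is a sequence $e_1e_2\cdots e_n$ of edges with $r(e_i)=s(e_{i-1})$ for $2\le i\le n$; vertices are paths of length $0$. The path $w=e_1\cdots e_n$ is a cycle if $r(e_1)=s(e_n)$, and is primitive if $w\ne u^k$ for every path $u$ and $k\ge 2$. $\mathcal{T}^{+}(Q)$ is the norm closed operator algebra generated by the left regular representation of $Q$: on the Hilbert space with orthonormal basis $\{\xi_u\}$ indexed by all finite paths $u$ (including vertices), $L_e\xi_u=\xi_{eu}$ if $r(u)=s(e)$ and $0$ otherwise, and $P_v\xi_u=\xi_u$ if $r(u)=v$ and $0$ otherwise; $\mathcal{T}^{+}(Q)$ is generated by $\{P_v,L_e\}$. With $e_{i,j}$ (two indices) the elementary matrices of $M_n$, $\pi_{w,\lambda,\mu}:\mathcal{T}^{+}(Q)\to M_n$ is the completely contractive homomorphism determined by $\pi_{w,\lambda,\mu}(P_v)=\sum_{s(e_j)=v}e_{j,j}$ and $\pi_{w,\lambda,\mu}(L_e)=\sum_{e_j=e}\lambda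 e_{j-1,j}$, where $e_{0,1}:=\mu e_{n,1}$. Given a completely contractive homomorphism $\pi:A\to B$, a derivation at $\pi$ is a continuous linear map $D:A\to B$ with $D(ab)=D(a)\pi(b)+\pi(a)D(b)$ for all $a,b\in A$. It is inner at $\pi$ if there is $X\in B$ with $D(a)=\pi(a)X-X\pi(a)$ for all $a\in A$. *)

(* Defs.v *)
From HB Require Import structures.
From mathcomp Require Import all_boot all_order all_algebra finmap.
From mathcomp Require Import all_classical all_reals.
From mathcomp Require Import ereal topology normedtype esum.
From mathcomp Require Import complex.
From mathcomp Require Import ring lra.

Set Implicit Arguments.
Unset Strict Implicit.
Unset Printing Implicit Defensive.

Import Order.TTheory GRing.Theory Num.Theory.
Import numFieldNormedType.Exports.

Local Open Scope classical_set_scope.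
Local Open Scope ring_scope.

(* R[i] are the complex numbers.  Its norm `|z| is R[i]-valued (a real element
   of R[i]); normc z : R is the same modulus as an element of R. *)
Notation normc := ComplexField.Normc.normc.

Section complex_modulus.
Variable R : realType.
Implicit Types (x y : R) (z w : R[i]).

Lemma normC_normc z : `|z| = (normc z)%:C%C.
Proof. by rewrite normc_def; case: z => a b. Qed.

Lemma lecR x y : (x%:C%C <= y%:C%C :> R[i]) = (x <= y).
Proof. by rewrite lecE /= eqxx. Qed.

Lemma normc_ge0 z : 0 <= normc z.
Proof. by case: z => a b; exact: sqrtr_ge0. Qed.

Lemma normcD z w : normc (z + w) <= normc z + normc w.
Proof. by rewrite -lecR rmorphD /= -!normC_normc ler_normD. Qed.

End complex_modulus.

Section square_sum.
Variables (R : realType) (I : choiceType).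
Implicit Types (f g : I -> R[i]).

Definition sqsum f : \bar R := \esum_(i in [set: I]) ((normc (f i) ^+ 2)%:E).

Lemma sqsum_leP f (M : R) :
  (sqsum f <= M%:E)%E <->
  forall X : {fset I}, \sum_(i <- X) normc (f i) ^+ 2 <= M.
Proof.
split=> [fM X|H].
  rewrite -lee_fin -sumEFin; apply: le_trans fM; apply: esum_ge.
  exists [set` X] => //.
  by rewrite fsbig_finite ?set_fsetK.
apply: ge_ereal_sup => _ [X [finX _] <-].
by rewrite fsbig_finite//= sumEFin lee_fin.
Qed.

Lemma sqsum_ge0 f : (0 <= sqsum f)%E.
Proof. by apply: esum_ge0 => i _; rewrite lee_fin sqr_ge0. Qed.

Lemma sqsum_fin f : (sqsum f < +oo)%E -> sqsum f = (fine (sqsum f))%:E.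
Proof. by move=> h; rewrite fineK// ge0_fin_numE// sqsum_ge0. Qed.

Lemma sqsum_minkowski f g (a b : R) : 0 <= a -> 0 <= b ->
  (sqsum f <= (a ^+ 2)%:E)%E -> (sqsum g <= (b ^+ 2)%:E)%E ->
  (sqsum (f \+ g)%R <= ((a + b) ^+ 2)%:E)%E.
Proof.
have null (h : I -> R[i]) i : (sqsum h <= (0 ^+ 2)%:E)%E -> h i = 0.
  move=> /sqsum_leP/(_ [fset i]%fset); rewrite big_seq_fset1 expr0n/= => h0.
  apply: ComplexField.Normc.eq0_normc.
  by apply/eqP; rewrite -sqrf_eq0 eq_le h0 sqr_ge0.
rewrite le_eqVlt => /predU1P[<-|a0].
  move=> _ fa gb; rewrite add0r (_ : f \+ g = g)//.
  by apply/funext => i /=; rewrite (null f i) ?add0r.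
rewrite le_eqVlt => /predU1P[<-|b0].
  move=> fa gb; rewrite addr0 (_ : f \+ g = f)//.
  by apply/funext => i /=; rewrite (null g i) ?addr0.
move=> /sqsum_leP fa /sqsum_leP gb; apply/sqsum_leP => X.
have an0 : a != 0 by rewrite gt_eqF.
have bn0 : b != 0 by rewrite gt_eqF.
have -> : (a + b) ^+ 2 = (1 + b / a) * a ^+ 2 + (1 + a / b) * b ^+ 2.
  by field; rewrite an0 bn0.
have ba0 : 0 <= 1 + b / a by rewrite addr_ge0// divr_ge0// ltW.
have ab0 : 0 <= 1 + a / b by rewrite addr_ge0// divr_ge0// ltW.
apply: le_trans (lerD (ler_wpM2l ba0 (fa X)) (ler_wpM2l ab0 (gb X))).
rewrite !mulr_sumr -big_split/=; apply: ler_sum => i _.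
set x := normc (f i); set y := normc (g i).
apply: (@le_trans _ _ ((x + y) ^+ 2)).
  by rewrite ler_pXn2r// ?nnegrE ?addr_ge0// ?normc_ge0// normcD.
rewrite -subr_ge0.
have -> : (1 + b / a) * x ^+ 2 + (1 + a / b) * y ^+ 2 - (x + y) ^+ 2
        = (b * x - a * y) ^+ 2 / (a * b) by field; rewrite an0 bn0.
by rewrite divr_ge0// ?sqr_ge0// mulr_ge0// ltW.
Qed.

Lemma sqsumZ_le f (c : R[i]) (M : R) : (sqsum f <= M%:E)%E ->
  (sqsum (fun i => c * f i)%R <= (normc c ^+ 2 * M)%:E)%E.
Proof.
move=> /sqsum_leP fM; apply/sqsum_leP => X.
under eq_bigr do rewrite ComplexField.Normc.normcM exprMn.
by rewrite -mulr_sumr ler_wpM2l// sqr_ge0.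
Qed.

End square_sum.

(* The Hilbert space l2(I) over the complex numbers, with orthonormal basis the
   [ket i]. *)
Section l2_space.
Variables (R : realType) (I : choiceType).

Definition l2_pred : {pred I -> R[i]} := [pred f | `[< (sqsum f < +oo)%E >]].

Record l2 := L2 { l2_fun :> I -> R[i] ; _ : l2_fun \in l2_pred }.

HB.instance Definition _ := [isSub for l2_fun].
HB.instance Definition _ := [Choice of l2 by <:].

Lemma l2_predP f : reflect (sqsum f < +oo)%E (f \in l2_pred).
Proof. exact: asboolP. Qed.

Lemma l2_submod_closed : submod_closed l2_pred.
Proof.
split=> [|c f g /l2_predP ff /l2_predP gf]; apply/l2_predP.
  apply: le_lt_trans (ltry 0); apply/sqsum_leP => X.
  by rewrite big1// => i _; rewrite ComplexField.Normc.normc0 expr0n.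
have cf : (sqsum (c *: f)%R <= ((normc c * Num.sqrt (fine (sqsum f))) ^+ 2)%:E)%E.
  rewrite exprMn sqr_sqrtr ?fine_ge0 ?sqsum_ge0//.
  by apply: sqsumZ_le; rewrite -sqsum_fin.
have g' : (sqsum g <= (Num.sqrt (fine (sqsum g)) ^+ 2)%:E)%E.
  by rewrite sqr_sqrtr ?fine_ge0 ?sqsum_ge0// -sqsum_fin.
apply: le_lt_trans (sqsum_minkowski _ _ cf g') (ltry _).
  by rewrite mulr_ge0 ?normc_ge0 ?sqrtr_ge0.
exact: sqrtr_ge0.
Qed.

HB.instance Definition _ :=
  GRing.isSubmodClosed.Build R[i] (I -> R[i]) l2_pred l2_submod_closed.
HB.instance Definition _ := [SubChoice_isSubLmodule of l2 by <:].

Definition l2norm (f : l2) : R := Num.sqrt (fine (sqsum (f : I -> R[i]))).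

Lemma l2norm_ge0 f : 0 <= l2norm f. Proof. exact: sqrtr_ge0. Qed.

Lemma l2norm_sqsum (f : l2) : sqsum f = (l2norm f ^+ 2)%:E.
Proof.
rewrite sqr_sqrtr ?fine_ge0 ?sqsum_ge0//.
by apply: sqsum_fin; exact/l2_predP/valP.
Qed.

Lemma l2norm_le (f : l2) (a : R) : 0 <= a ->
  (l2norm f <= a) = (sqsum f <= (a ^+ 2)%:E)%E.
Proof.
by move=> a0; rewrite l2norm_sqsum lee_fin ler_pXn2r// nnegrE// l2norm_ge0.
Qed.

Lemma l2normD (f g : l2) : l2norm (f + g) <= l2norm f + l2norm g.
Proof.
rewrite l2norm_le ?addr_ge0 ?l2norm_ge0//.
by apply: sqsum_minkowski; rewrite ?l2norm_ge0 ?l2norm_sqsum.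
Qed.

Lemma l2normZ (c : R[i]) (f : l2) : l2norm (c *: f) = normc c * l2norm f.
Proof.
have le d (g : l2) : l2norm (d *: g) <= normc d * l2norm g.
  rewrite l2norm_le ?mulr_ge0 ?normc_ge0 ?l2norm_ge0// exprMn.
  by apply: sqsumZ_le; rewrite l2norm_sqsum.
apply/eqP; rewrite eq_le le/=.
have [->|c0] := eqVneq c 0.
  by rewrite ComplexField.Normc.normc0 mul0r l2norm_ge0.
have nc0 : 0 < normc c.
  rewrite lt_neqAle normc_ge0 andbT eq_sym; apply/eqP.
  by move=> /ComplexField.Normc.eq0_normc/eqP; apply/negP.
have := le c^-1 (c *: f).
by rewrite scalerA mulVf// scale1r ComplexField.Normc.normcV ler_pdivlMl.
Qed.

Lemma l2norm_eq0 (f : l2) : l2norm f = 0 -> f = 0.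
Proof.
move=> f0; apply/val_inj/funext => i /=.
have : (sqsum f <= 0%:E)%E by rewrite l2norm_sqsum f0 expr0n.
move=> /sqsum_leP/(_ [fset i]%fset); rewrite big_seq_fset1 => h0.
by apply/ComplexField.Normc.eq0_normc/eqP; rewrite -sqrf_eq0 eq_le h0 sqr_ge0.
Qed.

Let norm (f : l2) : R[i] := (l2norm f)%:C%C.

Let normD f g : norm (f + g) <= norm f + norm g.
Proof. by rewrite /norm -rmorphD lecR l2normD. Qed.

Let normZ (c : R[i]) f : norm (c *: f) = `|c| * norm f.
Proof. by rewrite normC_normc /norm -rmorphM l2normZ. Qed.

Let norm_eq0 f : norm f = 0 -> f = 0.
Proof. by move=> /(congr1 (@complex.Re R)) /l2norm_eq0. Qed.

HB.instance Definition _ :=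
  Lmodule_isNormed.Build R[i] l2 normD normZ norm_eq0.

Lemma l2_normE (f : l2) : `|f| = (l2norm f)%:C%C. Proof. by []. Qed.

Definition ket_fun (i : I) : I -> R[i] := fun j => (j == i)%:R.

Lemma ket_subproof i : ket_fun i \in l2_pred.
Proof.
apply/l2_predP/(le_lt_trans _ (ltry 1))/sqsum_leP => X.
rewrite (bigID (pred1 i))/= [X in _ + X]big1 ?addr0; last first.
  by move=> j /negPf ji; rewrite /ket_fun ji ComplexField.Normc.normc0 expr0n.
have [iX|iX] := boolP (i \in X).
  rewrite -big_filter filter_pred1_uniq// big_seq1 /ket_fun eqxx.
  by rewrite ComplexField.Normc.normc1 expr1n.
by rewrite big_seq_cond big1// => j /andP[jX /eqP ji]; rewrite -ji jX in iX.
Qed.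

Definition ket (i : I) : l2 := L2 (ket_subproof i).

End l2_space.

(* The least bound of T with respect to the norms NV and NW. *)
Definition opnorm (R : realType) (V W : Type) (NV : V -> R) (NW : W -> R)
    (T : V -> W) : R :=
  inf [set M : R | 0 <= M /\ forall x, NW (T x) <= M * NV x].

Section bounded_operators.
Variables (R : realType) (I : choiceType).
Local Notation H := (l2 R I).

Definition bop_pred : {pred H -> H} :=
  [pred T | `[< linear T /\ continuous T >]].

Record bop := Bop { bop_fun :> H -> H ; _ : bop_fun \in bop_pred }.

HB.instance Definition _ := [isSub for bop_fun].
HB.instance Definition _ := [Choice of bop by <:].

Lemma bop_predP T : reflect (linear T /\ continuous T) (T \in bop_pred).
Proof. exact: asboolP. Qed.

Lemma bop_submod_closed : submod_closed bop_pred.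
Proof.
split=> [|c S T /bop_predP[linS ctsS] /bop_predP[linT ctsT]]; apply/bop_predP.
  by split=> [a x y|]; [rewrite /= scaler0 addr0|exact: cst_continuous].
split=> [a x y|x].
  have E z : (c *: S + T) z = c *: S z + T z by [].
  rewrite !E linS linT !scalerDr !scalerA [c * a]mulrC.
  by rewrite addrACA.
by apply: continuousD; [apply: continuousZr; exact: ctsS|exact: ctsT].
Qed.

HB.instance Definition _ :=
  GRing.isSubmodClosed.Build R[i] (H -> H) bop_pred bop_submod_closed.
HB.instance Definition _ := [SubChoice_isSubLmodule of bop by <:].

Lemma bop_linear (T : bop) : linear T.
Proof. by case: T => T /= /bop_predP[]. Qed.

Lemma bop_continuous (T : bop) : continuous T.
Proof. by case: T => T /= /bop_predP[]. Qed.

HB.instance Definition _ (T : bop) :=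
  GRing.isLinear.Build R[i] H H *:%R T (bop_linear T).

Lemma bop1_subproof : @id H \in bop_pred.
Proof. by apply/bop_predP; split=> // x; exact: cvg_id. Qed.

Lemma bopM_subproof (S T : bop) : (S : H -> H) \o T \in bop_pred.
Proof.
apply/bop_predP; split=> [a x y|x]; first by rewrite /= !linearP.
by apply: continuous_comp; exact: bop_continuous.
Qed.

Definition bop1 : bop := Bop bop1_subproof.
Definition bopM (S T : bop) : bop := Bop (bopM_subproof S T).

Lemma bopMA : associative bopM.
Proof. by move=> S T U; exact/val_inj. Qed.

Lemma bop1M : left_id bop1 bopM.
Proof. by move=> S; exact/val_inj. Qed.

Lemma bopM1 : right_id bop1 bopM.
Proof. by move=> S; exact/val_inj. Qed.

Lemma bopMDl : left_distributive bopM +%R.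
Proof. by move=> S T U; apply/val_inj/funext. Qed.

Lemma bopMDr : right_distributive bopM +%R.
Proof. by move=> S T U; apply/val_inj/funext => x /=; rewrite linearD. Qed.

(* Multiplication is composition; I may be empty, so that 1 = 0 is allowed. *)
HB.instance Definition _ :=
  GRing.Zmodule_isPzRing.Build bop bopMA bop1M bopM1 bopMDl bopMDr.

Lemma bopME (S T : bop) x : (S * T) x = S (T x). Proof. by []. Qed.

Lemma bop_bound (T : bop) :
  exists2 M : R, 0 <= M & forall x, l2norm (T x) <= M * l2norm x.
Proof.
have : bounded_near T (nbhs (0 : H)).
  by apply: continuous_linear_bounded; exact: bop_continuous.
move=> /linear_boundedP/pinfty_ex_gt0[r r0 Tr].
have rE : r = (complex.Re r)%:C%C.
  by case: r r0 {Tr} => a b; rewrite ltcE /= => /andP[/eqP->].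
exists (complex.Re r); first by rewrite -lecR -rE ltW.
by move=> x; have := Tr x; rewrite !l2_normE rE -rmorphM lecR.
Qed.

Lemma bop_pred_bound (T : H -> H) (M : R) : linear T ->
  (forall x, l2norm (T x) <= M * l2norm x) -> T \in bop_pred.
Proof.
move=> linT TM; apply/bop_predP; split=> //.
pose L := GRing.isLinear.Build R[i] H H *:%R T linT.
pose T' : {linear H -> H} := HB.pack T L.
apply: (@bounded_linear_continuous _ _ _ T').
apply/linear_boundedP; near=> r => x.
apply: (@le_trans _ _ (M%:C%C * `|x|)).
  by rewrite !l2_normE -rmorphM lecR TM.
by apply: ler_wpM2r => //; near: r; apply: nbhs_pinfty_ge; rewrite complex_real eqxx.
Unshelve. all: by end_near. Qed.

Definition bop_norm (T : bop) : R := opnorm (@l2norm R I) (@l2norm R I) T.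

Let bound_set (T : bop) :=
  [set M : R | 0 <= M /\ forall x, l2norm (T x) <= M * l2norm x].

Let bound_set_inf (T : bop) : has_inf (bound_set T).
Proof.
split; last by exists 0 => M [].
by have [M M0 TM] := bop_bound T; exists M.
Qed.

Lemma bop_norm_le (T : bop) (M : R) : 0 <= M ->
  (forall x, l2norm (T x) <= M * l2norm x) -> bop_norm T <= M.
Proof.
by move=> M0 TM; apply: ge_inf; [have [] := bound_set_inf T|split].
Qed.

Lemma bop_norm_ge0 (T : bop) : 0 <= bop_norm T.
Proof. by apply: lb_le_inf => [|M []//]; have [] := bound_set_inf T. Qed.

Lemma bop_normP (T : bop) x : l2norm (T x) <= bop_norm T * l2norm x.
Proof.
have := l2norm_ge0 x; rewrite le_eqVlt => /predU1P[/esym x0|x0].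
  by rewrite x0 mulr0; have [M _ /(_ x)] := bop_bound T; rewrite x0 mulr0.
rewrite -ler_pdivrMr//; apply: lb_le_inf; first by have [] := bound_set_inf T.
by move=> M [_ TM]; rewrite ler_pdivrMr.
Qed.

Let norm (T : bop) : R[i] := (bop_norm T)%:C%C.

Let normD S T : norm (S + T) <= norm S + norm T.
Proof.
rewrite /norm -rmorphD lecR; apply: bop_norm_le => [|x].
  by rewrite addr_ge0 ?bop_norm_ge0.
by rewrite mulrDl; apply: le_trans (l2normD _ _) _; rewrite lerD ?bop_normP.
Qed.

Let normZ (c : R[i]) T : norm (c *: T) = `|c| * norm T.
Proof.
have le d (S : bop) : bop_norm (d *: S) <= normc d * bop_norm S.
  apply: bop_norm_le => [|x]; first by rewrite mulr_ge0 ?normc_ge0 ?bop_norm_ge0.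
  by rewrite l2normZ -mulrA ler_wpM2l ?normc_ge0 ?bop_normP.
rewrite normC_normc /norm -rmorphM; congr (_%:C)%C.
apply/eqP; rewrite eq_le le/=.
have [->|c0] := eqVneq c 0.
  by rewrite ComplexField.Normc.normc0 mul0r bop_norm_ge0.
have nc0 : 0 < normc c.
  rewrite lt_neqAle normc_ge0 andbT eq_sym; apply/eqP.
  by move=> /ComplexField.Normc.eq0_normc/eqP; apply/negP.
have := le c^-1 (c *: T).
by rewrite scalerA mulVf// scale1r ComplexField.Normc.normcV ler_pdivlMl.
Qed.

Let norm_eq0 T : norm T = 0 -> T = 0.
Proof.
move=> /(congr1 (@complex.Re R))/= T0; apply/val_inj/funext => x.
apply: l2norm_eq0; apply/eqP; rewrite eq_le l2norm_ge0 andbT.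
by have := bop_normP T x; rewrite T0 mul0r.
Qed.

HB.instance Definition _ :=
  Lmodule_isNormed.Build R[i] bop normD normZ norm_eq0.

Lemma bop_normE (T : bop) : `|T| = (bop_norm T)%:C%C. Proof. by []. Qed.

End bounded_operators.

(* The operator sending the basis vector [ket i] to [ket j] when t j = Some i,
   and to 0 when there is no such j. *)
Section partial_isometry.
Variables (R : realType) (I : choiceType) (t : I -> option I).
Hypothesis t_inj : forall i j k, t i = Some k -> t j = Some k -> i = j.

Definition transfer_fun (f : I -> R[i]) : I -> R[i] :=
  fun j => if t j is Some i then f i else 0.

Lemma sqsum_transfer f (M : R) :
  (sqsum f <= M%:E)%E -> (sqsum (transfer_fun f) <= M%:E)%E.
Proof.
move=> /sqsum_leP fM; apply/sqsum_leP => X.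
have -> : \sum_(j <- X) normc (transfer_fun f j) ^+ 2
        = \sum_(i <- pmap t X) normc (f i) ^+ 2.
  elim: (X : seq I) => [|j s IH]; first by rewrite !big_nil.
  rewrite big_cons IH {1}/transfer_fun [pmap t (j :: s)]/=.
  case: (t j) => [i|]; first by rewrite big_cons.
  by rewrite ComplexField.Normc.normc0 expr0n add0r.
have upX : uniq (pmap t X).
  have := fset_uniq X; elim: (X : seq I) => //= j s IH /andP[js /IH us].
  case tj : (t j) => [i|] //=; rewrite us andbT.
  apply: contra js; rewrite mem_pmap => /mapP[k ks tk].
  by rewrite (t_inj tj (esym tk)).
have := fM [fset i in pmap t X]%fset; apply: le_trans.
rewrite le_eqVlt; apply/orP; left; apply/eqP/perm_big.
rewrite perm_sym -[X in perm_eq _ X](undup_id upX).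
by apply: uniq_perm; rewrite ?fset_uniq ?undup_uniq// => i;
  rewrite mem_undup !inE.
Qed.

Lemma transfer_subproof (f : l2 R I) :
  transfer_fun (f : I -> R[i]) \in @l2_pred R I.
Proof.
apply/l2_predP/(le_lt_trans _ (ltry (l2norm f ^+ 2))).
by apply: sqsum_transfer; rewrite l2norm_sqsum.
Qed.

Definition transfer_l2 (f : l2 R I) : l2 R I := L2 (transfer_subproof f).

Lemma transfer_bop_subproof : transfer_l2 \in @bop_pred R I.
Proof.
apply: (@bop_pred_bound _ _ _ 1) => [a f g|f].
  apply/val_inj/funext => j.
  change (transfer_fun (a *: f + g) j
          = a * transfer_fun f j + transfer_fun g j).
  by rewrite /transfer_fun; case: (t j) => [i|]; rewrite ?mulr0 ?addr0.
rewrite mul1r l2norm_le ?l2norm_ge0//.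
by apply: sqsum_transfer; rewrite l2norm_sqsum.
Qed.

Definition transfer : bop R I := Bop transfer_bop_subproof.

Lemma transferE (f : l2 R I) j :
  transfer f j = if t j is Some i then f i else 0.
Proof. by []. Qed.

End partial_isometry.

Record digraph := Digraph {
  vert : choiceType;
  edge : choiceType;
  rng : edge -> vert;
  src : edge -> vert }.

Section paths.
Variable Q : digraph.
Implicit Types (e f : edge Q) (v : vert Q) (s u w : seq (edge Q)).

Definition composable e f : bool := rng f == src e.

Definition is_path s : bool := sorted composable s.

(* A cycle has length at least 1. *)
Definition is_cycle w : bool :=
  if w is e :: s then is_path w && (rng e == src (last e s)) else false.

Definition path_pow u (k : nat) : seq (edge Q) := flatten (nseq k u).

(* All the paths of length 0 are represented here by the empty sequence: their
   powers have length 0, so they add no condition on a cycle w. *)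
Definition primitive w : Prop :=
  forall u (k : nat), is_path u -> (2 <= k)%N -> w <> path_pow u k.

(* The pair (v, e_1 ... e_n) encodes the path e_1 ... e_n when n > 0, in which
   case v must be its source s(e_n), and the vertex v when n = 0. *)
Definition is_gpath (p : vert Q * seq (edge Q)) : bool :=
  is_path p.2 && (if p.2 is e :: s then src (last e s) == p.1 else true).

Record gpath := GPath { gpath_val :> vert Q * seq (edge Q) ;
                        _ : is_gpath gpath_val }.

HB.instance Definition _ := [isSub for gpath_val].
HB.instance Definition _ := [Choice of gpath by <:].

Definition gpath_rng (u : gpath) : vert Q :=
  if (val u).2 is e :: _ then rng e else (val u).1.

(* The path e u, if r(u) = s(e). *)
Definition econs e (u : gpath) : option gpath :=
  insub ((val u).1, e :: (val u).2).

Lemma econsE e (u : gpath) : isSome (econs e u) = (gpath_rng u == src e).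
Proof.
rewrite /econs (isSome_insub gpath) /gpath_rng.
case: u => [[v [|f s]]] /=; first by move=> _; rewrite /is_gpath /= eq_sym.
by rewrite /is_gpath /= => /andP[-> ->]; rewrite !andbT.
Qed.

(* The path u with w = e u, if there is one. *)
Definition euncons e (w : gpath) : option gpath :=
  if (val w).2 is f :: s then
    if f == e then insub ((val w).1, s) else None
  else None.

Lemma euncons_econs e (u w : gpath) : (euncons e w == Some u) = (econs e u == Some w).
Proof.
apply/eqP/eqP.
  rewrite /euncons; case wE : (val w) => [v [|f s]] //=.
  case: eqP => // <-; case: insubP => // u' _ u'E [<-].
  rewrite /econs u'E /= -wE insubT ?(valP w)// => p; congr Some.
  exact/val_inj.
rewrite /econs; case: insubP => // w' _ w'E [<-].
rewrite /euncons w'E /= eqxx -surjective_pairing insubT ?(valP u)// => p.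
by congr Some; exact/val_inj.
Qed.

Lemma euncons_inj e (w w' u : gpath) :
  euncons e w = Some u -> euncons e w' = Some u -> w = w'.
Proof.
by move=> /eqP + /eqP; rewrite !euncons_econs => /eqP-> /eqP[].
Qed.

Definition vselect v (u : gpath) : option gpath :=
  if gpath_rng u == v then Some u else None.

Lemma vselect_inj v (w w' u : gpath) :
  vselect v w = Some u -> vselect v w' = Some u -> w = w'.
Proof. by rewrite /vselect; do 2!case: eqP => // _; move=> [->] [->]. Qed.

End paths.

Section tensor_algebra.
Variables (R : realType) (Q : digraph).
Local Notation B := (bop R (gpath Q)).

(* The left regular representation; see Lreg_ket and Preg_ket. *)
Definition Lreg (e : edge Q) : B := transfer R (@euncons_inj Q e).

Definition Preg (v : vert Q) : B := transfer R (@vselect_inj Q v).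

Lemma Lreg_ket e u :
  Lreg e (ket R u) = if econs e u is Some eu then ket R eu else 0.
Proof.
apply/val_inj/funext => w.
rewrite [LHS]/(transfer_fun _ _ _) /transfer_fun.
have := euncons_econs e u w.
case: (euncons e w) => [u'|]; case: (econs e u) => [eu|] //=.
- move=> E; have {}E : (u' == u) = (eu == w) by [].
  by rewrite /ket_fun E eq_sym.
- by move=> E; have {}E : (u' == u) = false by []; rewrite /ket_fun E.
- move=> E; have {}E : false = (eu == w) by [].
  by rewrite /ket_fun eq_sym -E.
Qed.

Lemma Preg_ket v u :
  Preg v (ket R u) = if gpath_rng u == v then ket R u else 0.
Proof.
apply/val_inj/funext => w.
rewrite [LHS]/(transfer_fun _ _ _) /transfer_fun /vselect.
have [<-|uw] := eqVneq u w; first by case: eqP.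
by do 2!case: ifP => //= _; rewrite /ket_fun eq_sym (negPf uw).
Qed.

Definition closed_subalgebra (A : set B) : Prop :=
  [/\ A 0,
      forall (c : R[i]) S T, A S -> A T -> A (c *: S + T),
      forall S T, A S -> A T -> A (S * T)
    & closed A].

Definition tensor_set : set B :=
  smallest closed_subalgebra (range Preg `|` range Lreg).

Lemma tensor_set_closed_subalgebra : closed_subalgebra tensor_set.
Proof.
split=> [A [[]]//|c S T AS AT A AA|S T AS AT A AA|].
- by case: (AA) => -[_ + _ _] _; apply; [exact: AS|exact: AT].
- by case: (AA) => -[_ _ + _] _; apply; [exact: AS|exact: AT].
- by apply: closed_bigI => A [[]].
Qed.

Definition tensor_pred : {pred B} := [pred T | `[< tensor_set T >]].

(* The algebra T^+(Q). *)
Record tensor_alg := TensorAlg { tensor_val :> B ;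
                                 _ : tensor_val \in tensor_pred }.

HB.instance Definition _ := [isSub for tensor_val].
HB.instance Definition _ := [Choice of tensor_alg by <:].

Lemma tensor_predP T : reflect (tensor_set T) (T \in tensor_pred).
Proof. exact: asboolP. Qed.

Lemma tensor_submod_closed : submod_closed tensor_pred.
Proof.
have [T0 TD _ _] := tensor_set_closed_subalgebra.
split=> [|c S T /tensor_predP AS /tensor_predP AT]; apply/tensor_predP => //.
exact: TD.
Qed.

HB.instance Definition _ :=
  GRing.isSubmodClosed.Build R[i] B tensor_pred tensor_submod_closed.
HB.instance Definition _ := [SubChoice_isSubLmodule of tensor_alg by <:].

Let norm (a : tensor_alg) : R[i] := `|val a|.

Let normD a b : norm (a + b) <= norm a + norm b.
Proof. exact: (ler_normD (val a) (val b)). Qed.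

Let normZ (c : R[i]) a : norm (c *: a) = `|c| * norm a.
Proof. exact: (normrZ c (val a)). Qed.

Let norm_eq0 a : norm a = 0 -> a = 0.
Proof. by move=> a0; apply/val_inj/normr0_eq0. Qed.

HB.instance Definition _ :=
  Lmodule_isNormed.Build R[i] tensor_alg normD normZ norm_eq0.

Lemma tensorM_subproof (a b : tensor_alg) : val a * val b \in tensor_pred.
Proof.
have [_ _ TM _] := tensor_set_closed_subalgebra.
apply/tensor_predP; apply: TM; apply/tensor_predP; last exact: (valP b).
exact: (valP a).
Qed.

(* T^+(Q) has no unit when Q has infinitely many vertices, so it is not given
   a ring structure. *)
Definition tensorM (a b : tensor_alg) : tensor_alg :=
  TensorAlg (tensorM_subproof a b).

Lemma tensorL_subproof e : Lreg e \in tensor_pred.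
Proof. by apply/tensor_predP => A [_]; apply; right; exists e. Qed.

Lemma tensorP_subproof v : Preg v \in tensor_pred.
Proof. by apply/tensor_predP => A [_]; apply; left; exists v. Qed.

Definition tensorL e : tensor_alg := TensorAlg (tensorL_subproof e).
Definition tensorP v : tensor_alg := TensorAlg (tensorP_subproof v).

End tensor_algebra.

Section complete_contractions.
Variables (R : realType) (k : nat).

(* The operator matrix a = [a_ij] acting on V^k, and the l2 norm on V^k. *)
Definition mxop (V : nmodType) (a : 'I_k -> 'I_k -> V -> V)
    (x : 'I_k -> V) : 'I_k -> V :=
  fun i => \sum_j a i j (x j).

Definition dsum_norm (V : Type) (N : V -> R) (x : 'I_k -> V) : R :=
  Num.sqrt (\sum_i N (x i) ^+ 2).

Definition mxop_norm (V : nmodType) (N : V -> R)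
    (a : 'I_k -> 'I_k -> V -> V) : R :=
  opnorm (dsum_norm N) (dsum_norm N) (mxop a).

End complete_contractions.

(* The Hilbert space norm of C^n; the library norm of 'cV_n is the sup norm. *)
Definition cvnorm (R : realType) (n : nat) (x : 'cV[R[i]]_n) : R :=
  Num.sqrt (\sum_i normc (x i 0) ^+ 2).

Section representations.
Variables (R : realType) (Q : digraph) (n : nat).
Local Notation A := (tensor_alg R Q).
Local Notation M := 'M[R[i]]_n.
Implicit Types (phi : {linear A -> M}) (D : {linear A -> M}).

(* M_k(T^+(Q)) is normed as operators on l2(gpath Q)^k, and M_k(M_n) as
   operators on (C^n)^k. *)
Definition completely_contractive phi : Prop :=
  forall (k : nat) (a : 'I_k -> 'I_k -> A),
    mxop_norm (@cvnorm R n) (fun i j => mulmx (phi (a i j))) <=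
    mxop_norm (@l2norm R (gpath Q)) (fun i j => a i j : _ -> _).

Definition cc_hom phi : Prop :=
  (forall a b, phi (tensorM a b) = phi a *m phi b) /\
  completely_contractive phi.

Definition derivation_at phi D : Prop :=
  continuous (D : A -> ('M[R[i]]_n : normedModType R[i])) /\
  forall a b, D (tensorM a b) = D a *m phi b + phi a *m D b.

Definition inner_at phi D : Prop :=
  exists X : M, forall a, D a = phi a *m X - X *m phi a.

(* Indices start at 0: tnth w j is the edge e_{j+1}, and ord_pred j is the
   cyclic predecessor of j. This is e_{j,j+1} in the 1-based notation, where
   e_{0,1} stands for mu e_{n,1}. *)
Definition unit_pred (mu : R[i]) (j : 'I_n) : M :=
  (if j == 0%N :> nat then mu else 1) *: delta_mx (ord_pred j) j.

(* phi is the homomorphism pi_{w,lam,mu}. *)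
Definition is_cycle_rep (w : n.-tuple (edge Q)) (lam mu : R[i]) phi : Prop :=
  [/\ cc_hom phi,
      forall v, phi (tensorP R v) =
        \sum_(j < n | src (tnth w j) == v) delta_mx j j
    & forall e, phi (tensorL R e) =
        \sum_(j < n | tnth w j == e) lam *: unit_pred mu j].

End representations.

(* Main.v *)
Require Import Defs.
From mathcomp Require Import all_boot all_order all_algebra.
From mathcomp Require Import all_classical all_reals.
From mathcomp Require Import ereal topology normedtype esum.
From mathcomp Require Import complex.
From mathcomp Require Import zify.

Import Order.TTheory GRing.Theory Num.Theory.
Import numFieldNormedType.Exports.
Local Open Scope ring_scope.

(** If [D] is inner, say [D a = phi a X - X phi a], it clearly vanishes where
    [phi] does.  Conversely, suppose [D] vanishes on the kernel of [phi].

    The point is that [phi] is onto the full matrix algebra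
    ([cycle_rep_surjective]).  The operator [L_e] is sent to a weighted cyclic
    shift, restricted to the positions of [w] that carry the edge [e]; hence
    the image of a word of edges of length at least [n] kills each basis row
    vector [i], unless that word is what one reads along the cycle [w] when
    starting after [i].  As [w] is primitive, different starting points read
    different words ([itinerary_inj]), so the image of a word that can be read
    is a nonzero multiple of a matrix unit, and every matrix unit arises in
    this way ([shift_word_delta]).

    Then [D] factors through [phi] as a derivation of the matrix algebra, and
    such a derivation is inner by the classical averaging formula
    ([derivation_inner]). *)

(** * Periods of words *)

Lemma periodic_muln (T : Type) (f : nat -> T) (p k : nat) :
  (forall x, f (x + p)%N = f x) -> forall x, f (x + k * p)%N = f x.
Proof.
by move=> fp x; elim: k => [|k IH]; rewrite ?mul0n ?addn0// mulSn addnCA addnC fp.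
Qed.

Lemma periodic_gcdn (T : Type) (f : nat -> T) (p q : nat) : (0 < p)%N ->
  (forall x, f (x + p)%N = f x) -> (forall x, f (x + q)%N = f x) ->
  forall x, f (x + gcdn p q)%N = f x.
Proof.
move=> p0 fp fq x; case: (egcdnP q p0) => u v uv _.
rewrite -(periodic_muln _ _ _ v fq) -addnA [(gcdn p q + _)%N]addnC -uv.
exact: periodic_muln.
Qed.

Section Powers.
Variable Q : digraph.

Lemma size_path_pow (u : seq (edge Q)) (k : nat) :
  size (path_pow u k) = (k * size u)%N.
Proof. by elim: k => //= k IH; rewrite /path_pow /= size_cat IH. Qed.

Lemma nth_path_pow (e : edge Q) (u : seq (edge Q)) (k x : nat) :
  (x < k * size u)%N -> nth e (path_pow u k) x = nth e u (x %% size u).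
Proof.
elim: k x => //= k IH x; rewrite mulSn => xk.
rewrite /path_pow /= nth_cat; case: ltnP => xu; first by rewrite modn_small.
rewrite IH; last by lia.
by rewrite -[in RHS](subnK xu) modnDr.
Qed.

(** A rotation by [d] fixing [w] makes the cyclic extension of [w] periodic of
    periods [d] and [size w], hence of period their gcd [g]; then [w] is the
    power of exponent [size w / g] of its prefix of length [g]. *)
Lemma primitive_no_period (e : edge Q) (w : seq (edge Q)) (d : nat) :
  is_path w -> primitive w -> (0 < d < size w)%N ->
  ~ (forall x, nth e w ((x + d) %% size w) = nth e w (x %% size w)).
Proof.
move=> pw prw /andP[d0 dw] wd; set n := size w in dw wd *.
pose f x := nth e w (x %% n).
have n0 : (0 < n)%N by exact: leq_ltn_trans dw.
have fg x : f (x + gcdn d n)%N = f x.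
  by apply: (@periodic_gcdn _ f) => // y; rewrite /f modnDr.
have g0 : (0 < gcdn d n)%N by rewrite gcdn_gt0 d0.
have gd : (gcdn d n <= d)%N by rewrite dvdn_leq// dvdn_gcdl.
have gn : (gcdn d n < n)%N by exact: leq_ltn_trans gd dw.
have sg : size (take (gcdn d n) w) = gcdn d n by rewrite size_takel// ltnW.
have nE : (n %/ gcdn d n * gcdn d n)%N = n by rewrite divnK// dvdn_gcdr.
apply: (prw (take (gcdn d n) w) (n %/ gcdn d n)%N).
- exact: take_sorted.
- by rewrite ltn_divRL ?dvdn_gcdr// mul1n.
apply: (@eq_from_nth _ e) => [|x xn]; first by rewrite size_path_pow sg nE.
rewrite nth_path_pow sg ?nE// nth_take ?ltn_mod//.
have := periodic_muln _ f _ (x %/ gcdn d n) fg (x %% gcdn d n).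
rewrite addnC -divn_eq /f modn_small// => ->; rewrite modn_small//.
by rewrite (leq_ltn_trans _ gn)// ltnW// ltn_mod.
Qed.

End Powers.

(** * Labelled weighted shifts *)

Section Shifts.
Variables (F : fieldType) (T : eqType) (n : nat).
Variables (lab : 'I_n -> T) (c : 'I_n -> F).

Definition shift (e : T) : 'M[F]_n :=
  \sum_(j < n | lab j == e) c j *: delta_mx (ord_pred j) j.

Definition shift_word (s : seq T) : 'M[F]_n :=
  foldr (fun e M => shift e *m M) 1%:M s.

(** The first label read is that of the successor of [i], since
    [delta_mx (ord_pred j) j] carries the label of [j]. *)
Definition itinerary (i : 'I_n) (m : nat) : seq T :=
  [seq lab j | j <- traject (@ordS n) (ordS i) m].

Definition weight (i : 'I_n) (m : nat) : F :=
  \prod_(j <- traject (@ordS n) (ordS i) m) c j.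

Lemma val_iter_ordS (i : 'I_n) (m : nat) :
  iter m (@ordS n) i = ((i + m) %% n)%N :> nat.
Proof.
elim: m => [|m IH] /=; first by rewrite addn0 modn_small.
by rewrite IH -addn1 modnDml addn1 addnS.
Qed.

Lemma row_shift (i : 'I_n) (e : T) :
  delta_mx 0 i *m shift e =
  if lab (ordS i) == e then c (ordS i) *: delta_mx 0 (ordS i)
  else 0 :> 'rV[F]_n.
Proof.
rewrite /shift mulmx_sumr.
have E j : delta_mx 0 i *m (c j *: delta_mx (ord_pred j) j) =
    if j == ordS i then c j *: delta_mx 0 j else 0 :> 'rV[F]_n.
  rewrite -scalemxAr mul_delta_mx_cond [i == _]eq_sym.
  rewrite (can2_eq (@ord_predK n) (@ordSK n)).
  by case: eqP => _; rewrite ?mulr0n ?scaler0// mulr1n.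
rewrite (eq_bigr _ (fun j _ => E j)) -big_mkcondr.
case: ifP => le; last first.
  by rewrite big1// => j /andP[lj /eqP ji]; rewrite -ji lj in le.
by rewrite (big_pred1 (ordS i))// => j /=; case: (eqVneq j (ordS i)) => [->|]; rewrite ?le ?andbF.
Qed.

(** Reading [s] moves the basis vector forward along the cycle, one label at a
    time; a wrong label kills it, as [i] has a single successor. *)
Lemma row_shift_word (i : 'I_n) (s : seq T) :
  delta_mx 0 i *m shift_word s =
  if s == itinerary i (size s)
  then weight i (size s) *: delta_mx 0 (iter (size s) (@ordS n) i)
  else 0 :> 'rV[F]_n.
Proof.
elim: s i => [|e s IH] i /=.
  by rewrite mulmx1 /weight big_nil scale1r.
rewrite mulmxA row_shift eqseq_cons [e == _]eq_sym; case: ifP => _ /=.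
  rewrite -scalemxAl IH; case: ifP => _; last by rewrite scaler0.
  by rewrite scalerA /weight /= big_cons -iterSr.
by rewrite mul0mx.
Qed.

Hypothesis c_neq0 : forall j, c j != 0.

Lemma weight_neq0 i m : weight i m != 0.
Proof. by rewrite prodf_seq_neq0; apply/allP => j _; exact: c_neq0. Qed.

Hypothesis itin_inj :
  forall i j m, (n <= m)%N -> itinerary i m = itinerary j m -> i = j.

(** The word read from [i] to [j] is lengthened by a full turn of the cycle, so
    that it determines its starting point. *)
Lemma shift_word_delta (i j : 'I_n) : exists (s : seq T) (a : F),
  s != [::] /\ delta_mx i j = a *: shift_word s.
Proof.
pose m := (j + (n - i) + n)%N; pose s := itinerary i m.
have nm : (n <= m)%N by exact: leq_addl.
have ss : size s = m by rewrite size_map size_traject.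
have ij : iter m (@ordS n) i = j.
  apply/val_inj; rewrite /= val_iter_ordS /m.
  have -> : (i + (j + (n - i) + n))%N = (2 * n + j)%N by have := ltn_ord i; lia.
  by rewrite modnMDl modn_small.
exists s, (weight i m)^-1; split.
  by rewrite -size_eq0 ss -lt0n (leq_trans _ nm)// (leq_trans _ (ltn_ord i)).
apply/row_matrixP => k; rewrite linearZ /= [row k (shift_word s)]rowE.
rewrite row_shift_word ss.
rewrite rowE mul_delta_mx_cond.
have -> : (s == itinerary k m) = (k == i).
  by apply/eqP/eqP => [/(itin_inj _ _ _ nm)|->].
case: eqP => [->|_]; last by rewrite scaler0 mulr0n.
by rewrite ij scalerA mulVf ?weight_neq0// scale1r mulr1n.
Qed.

End Shifts.

Arguments shift {F T n}.
Arguments shift_word {F T n}.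
Arguments itinerary {T n}.

Lemma itinerary_inj (Q : digraph) (n : nat) (w : n.-tuple (edge Q)) :
  is_path w -> primitive w -> forall (i j : 'I_n) (m : nat), (n <= m)%N ->
  itinerary (tnth w) i m = itinerary (tnth w) j m -> i = j.
Proof.
move=> pw prw i j m nm ijm; pose e := tnth w i.
have E k : (k < n)%N ->
    nth e w ((i + k.+1) %% n) = nth e w ((j + k.+1) %% n).
  move=> kn; have km := leq_trans kn nm.
  have R l : nth e (itinerary (tnth w) l m) k = nth e w ((l + k.+1) %% n).
    rewrite (nth_map (ordS l)) ?size_traject// nth_traject// -iterSr.
    by rewrite (tnth_nth e) val_iter_ordS.
  by rewrite -!R ijm.
have no (a b : 'I_n) : (forall k, (k < n)%N ->
    nth e w ((a + k.+1) %% n) = nth e w ((b + k.+1) %% n)) -> ~~ (a < b)%N.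
  move=> ab; apply/negP => lt_ab.
  have bn := ltn_ord b.
  apply: (@primitive_no_period _ e w (b - a)%N pw prw).
    by rewrite size_tuple subn_gt0 lt_ab /= (leq_ltn_trans (leq_subr _ _)).
  rewrite size_tuple => x.
  (* [k] is the offset with [a + k + 1 = x] modulo [n]. *)
  pose k := ((x + (n - a) + n.-1) %% n)%N.
  have kn : (k < n)%N by rewrite ltn_mod; lia.
  have := ab k kn.
  have -> : ((a + k.+1) %% n = x %% n)%N.
    rewrite addnS -addSn modnDmr.
    have -> : (a.+1 + (x + (n - a) + n.-1) = 2 * n + x)%N by lia.
    by rewrite modnMDl.
  have -> : ((b + k.+1) %% n = (x + (b - a)) %% n)%N.
    rewrite addnS -addSn modnDmr.
    have -> : (b.+1 + (x + (n - a) + n.-1) = 2 * n + (x + (b - a)))%N by lia.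
    by rewrite modnMDl.
  by [].
apply/val_inj/eqP; rewrite /= eqn_leq [(i <= j)%N]leqNgt [(j <= i)%N]leqNgt.
by rewrite !no// => k kn; rewrite E.
Qed.

(** * Surjectivity of cycle representations *)

Lemma cycle_rep_surjective (R : realType) (Q : digraph) (n : nat)
    (w : n.-tuple (edge Q)) (lam mu : R[i])
    (phi : {linear tensor_alg R Q -> 'M[R[i]]_n}) :
  is_path w -> primitive w -> lam != 0 -> mu != 0 ->
  is_cycle_rep w lam mu phi -> forall M, exists a, phi a = M.
Proof.
move=> pw prw lam0 mu0 [[phiM _] _ phiL] M.
pose c (j : 'I_n) := lam * (if j == 0%N :> nat then mu else 1).
have c0 j : c j != 0 by rewrite mulf_neq0//; case: ifP => _; rewrite ?oner_eq0.
have phiS e : phi (tensorL R e) = shift (tnth w) c e.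
  by rewrite phiL; apply: eq_bigr => j _; rewrite /unit_pred scalerA.
have word s : s != [::] -> exists a, phi a = shift_word (tnth w) c s.
  elim: s => //= e [|f s] IH _; first by exists (tensorL R e); rewrite /= mulmx1.
  have [//|a aE] := IH _; exists (tensorM (tensorL R e) a).
  by rewrite phiM aE phiS.
have unit i j : exists a, phi a = delta_mx i j.
  have inj := itinerary_inj _ _ _ pw prw.
  have [s [x [s0 ->]]] := shift_word_delta _ _ _ _ _ c0 inj i j.
  by have [a aE] := word s s0; exists (x *: a); rewrite linearZ /= aE.
have /choice[u uE] (p : 'I_n * 'I_n) : exists a, phi a = delta_mx p.1 p.2.
  exact: unit.
exists (\sum_i \sum_j M i j *: u (i, j)).
rewrite [RHS]matrix_sum_delta linear_sum; apply: eq_bigr => i _.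
by rewrite linear_sum; apply: eq_bigr => j _; rewrite linearZ /= uE.
Qed.

(** * Derivations of matrix algebras *)

(** With [u i] a lift of the matrix unit [(i, k)] and [E] the matrix units, the
    average [X = - \sum_i D (u i) E_(k, i)] implements [D], because
    [\sum_i E_(i, k) E_(k, i) = 1].  Vanishing on the kernel is used to compare
    [D] at [a (u i)] and at a combination of the [u p] with the same image. *)
Lemma derivation_inner (F : fieldType) (A : lmodType F) (mul : A -> A -> A)
    (n : nat) (phi D : {linear A -> 'M[F]_n}) :
  (0 < n)%N ->
  (forall a b, phi (mul a b) = phi a *m phi b) ->
  (forall M, exists a, phi a = M) ->
  (forall a b, D (mul a b) = D a *m phi b + phi a *m D b) ->
  (forall a, phi a = 0 -> D a = 0) ->
  exists X : 'M[F]_n, forall a, D a = phi a *m X - X *m phi a.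
Proof.
move=> n0 phiM surj DM D0; pose k := Ordinal n0.
have /choice[u uE] (i : 'I_n) : exists a, phi a = delta_mx i k by exact: surj.
have Deq a b : phi a = phi b -> D a = D b.
  move=> ab; apply/eqP; rewrite -subr_eq0 -raddfB; apply/eqP/D0.
  by rewrite raddfB /= ab subrr.
exists (- \sum_i D (u i) *m delta_mx k i) => a.
have unitD : \sum_i delta_mx i k *m delta_mx k i = 1%:M :> 'M[F]_n.
  by rewrite mx1_sum_delta; apply: eq_bigr => i _; rewrite mul_delta_mx.
have Dau i : D (mul a (u i)) = \sum_p phi a p i *: D (u p).
  have -> : \sum_p phi a p i *: D (u p) = D (\sum_p phi a p i *: u p).
    by rewrite linear_sum; apply: eq_bigr => p _; rewrite linearZ.
  apply: Deq; rewrite phiM uE linear_sum.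
  rewrite [in LHS](matrix_sum_delta (phi a)) mulmx_suml; apply: eq_bigr => p _.
  rewrite mulmx_suml (bigD1 i)//= big1 ?addr0 => [|q qi].
    by rewrite -scalemxAl mul_delta_mx linearZ /= uE.
  by rewrite -scalemxAl mul_delta_mx_0// scaler0.
have XM : (\sum_i D (u i) *m delta_mx k i) *m phi a =
    \sum_i D (mul a (u i)) *m delta_mx k i.
  transitivity (\sum_p \sum_i phi a p i *: (D (u p) *m delta_mx k i)).
    rewrite mulmx_suml; apply: eq_bigr => p _.
    rewrite -mulmxA [in LHS](matrix_sum_delta (phi a)) mulmx_sumr (bigD1 p)//=.
    rewrite [X in _ + X]big1 ?addr0 => [|q qp]; last first.
      rewrite mulmx_sumr big1// => i _.
      by rewrite -scalemxAr mul_delta_mx_0 1?eq_sym// scaler0.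
    rewrite !mulmx_sumr; apply: eq_bigr => i _.
    by rewrite -scalemxAr mul_delta_mx -scalemxAr.
  rewrite exchange_big; apply: eq_bigr => i _.
  by rewrite Dau mulmx_suml; apply: eq_bigr => p _; rewrite -scalemxAl.
rewrite mulmxN mulNmx opprK XM addrC mulmx_sumr -sumrB.
rewrite -[LHS]mulmx1 -unitD mulmx_sumr; apply: eq_bigr => i _.
by rewrite DM uE mulmxDl !mulmxA addrK.
Qed.

Theorem lemma4p1 (R : realType) (Q : digraph) (n : nat)
    (w : n.-tuple (edge Q)) (lam mu : R[i])
    (phi D : {linear tensor_alg R Q -> 'M[R[i]]_n}) :
  is_cycle w -> primitive w ->
  `|lam| <= 1 -> lam != 0 -> `|mu| = 1 ->
  is_cycle_rep w lam mu phi ->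
  derivation_at phi D ->
  (inner_at phi D <-> forall a, phi a = 0 -> D a = 0).
Proof.
move=> cw prw _ lam0 mu1 rep [_ DM]; split=> [[X DX] a a0|D0].
  by rewrite DX a0 mul0mx mulmx0 subrr.
have n0 : (0 < n)%N by rewrite -(size_tuple w); case: (tval w) cw.
have pw : is_path w by case: (tval w) cw => // e s /andP[].
have mu0 : mu != 0 by rewrite -normr_eq0 mu1 oner_eq0.
have [[phiM _] _ _] := rep.
apply: derivation_inner DM D0 => //.
exact: cycle_rep_surjective rep.
Qed.
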